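(* Let $\mathbf w$ and $\mathbf w'$ be the normalized IPW vectors, with known regression parameter $\boldsymbol\lambda^*\in\mathbb R^p$, for datasets $\mathcal D$ and $\mathcal D'$ of size $n$ that differ at a single observation. Suppose that every covariate vector (in $\mathcal D$ and $\mathcal D'$) satisfies $\|\mathbf x_i\|_2\le M$ and that $\|\boldsymbol\lambda^*\|_2\le R_{\mathrm{IPW}}$. Then $$\|\mathbf w-\mathbf w'\|_2\le\sqrt2\,\exp(MR_{\mathrm{IPW}}).$$
   Context: A dataset is $\mathcal D=(\mathbf x_i,a_i)_{i=1}^n$ with $\mathbf x_i\in\mathbb R^p$ and $a_i\in\{0,1\}$. The true propensity score is the known logistic model $\mathbb P(A_i=1\mid X=\mathbf x_i)=\frac{\exp(\langle\mathbf x_i,\boldsymbol\lambda^*\rangle)}{1+\exp(\langle\mathbf x_i,\boldsymbol\lambda^*\rangle)}$. Put $f_i=1+\exp(-(2a_i-1)\langle\mathbf x_i,\boldsymbol\lambda^*\rangle)$, the inverse probability of the observed treatment. The normalized IPW vector is $\mathbf w=(w_1,\dots,w_n)$ with $w_i=n\,f_i/\sum_{j=1}^nf_j$; $\mathbf w'$ is defined in the same way from $\mathcal D'$ with the same $\boldsymbol\lambda^*$. *)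

(* Defs.v *)
From mathcomp Require Import all_boot all_order all_algebra.
From mathcomp Require Import all_reals sequences exp.

Set Implicit Arguments.
Unset Strict Implicit.
Unset Printing Implicit Defensive.

Import Order.TTheory GRing.Theory Num.Theory.
Local Open Scope ring_scope.

Definition dotp (R : realType) (p : nat) (u v : 'rV[R]_p) : R :=
  \sum_(k < p) u 0 k * v 0 k.

(* The library norm `|u| on row vectors is the sup norm, hence this one. *)
Definition norm2 (R : realType) (p : nat) (u : 'rV[R]_p) : R :=
  Num.sqrt (dotp u u).

(* An observation is a pair (x_i, a_i); [true] encodes treatment a_i = 1. *)
Definition dataset (R : realType) (p n : nat) : Type :=
  'I_n -> 'rV[R]_p * bool.

Definition covariate (R : realType) (p n : nat) (D : dataset R p n) (i : 'I_n)
  : 'rV[R]_p := (D i).1.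

Definition treatment (R : realType) (p n : nat) (D : dataset R p n) (i : 'I_n)
  : bool := (D i).2.

Definition propensity (R : realType) (p : nat) (lambda x : 'rV[R]_p) : R :=
  expR (dotp x lambda) / (1 + expR (dotp x lambda)).

Definition inverse_prob (R : realType) (p n : nat) (lambda : 'rV[R]_p)
    (D : dataset R p n) (i : 'I_n) : R :=
  1 + expR (- (2 * (treatment D i)%:R - 1) * dotp (covariate D i) lambda).

Lemma inverse_probE (R : realType) (p n : nat) (lambda : 'rV[R]_p)
    (D : dataset R p n) (i : 'I_n) :
  inverse_prob lambda D i =
  (if treatment D i then propensity lambda (covariate D i)
   else 1 - propensity lambda (covariate D i))^-1.
Proof.
rewrite /inverse_prob /propensity.
set t := dotp _ _.
have e0 : expR t != 0 by rewrite gt_eqF // expR_gt0.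
have s0 : 1 + expR t != 0 by rewrite gt_eqF // addr_gt0 // expR_gt0.
case: (treatment D i) => /=.
  rewrite mulr1 (_ : 2 - 1 = 1 :> R); last exact: addrK.
  by rewrite mulN1r expRN invf_div mulrDl mul1r divff // addrC.
by rewrite mulr0 sub0r opprK mul1r -{2}(divff s0) -mulrBl addrK div1r invrK.
Qed.

Definition ipw_weights (R : realType) (p n : nat) (lambda : 'rV[R]_p)
    (D : dataset R p n) : 'rV[R]_n :=
  \row_i (n%:R * inverse_prob lambda D i / \sum_(j < n) inverse_prob lambda D j).

(* Replace-one adjacency: only the observation at one index may differ. *)
Definition differ_at_one (R : realType) (p n : nat) (D D' : dataset R p n)
  : Prop :=
  exists i : 'I_n, forall j : 'I_n, j != i -> D j = D' j.

(* Main.v *)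
(** Let [k] be the index where the data differ, [S] the sum of the [f_j] over
    [j != k], and [T = S + f_k], [T' = S + f'_k] the two totals. With
    [c = n (f_k - f'_k) / (T T')] the difference of the weights is [c S] at [k]
    and [- c f_j] elsewhere, so its squared norm is at most [2 (c S)^2]. By
    Cauchy-Schwarz the [f_i] lie in [[1 + exp (- L), 1 + exp L]], [L = M R_IPW];
    as the ratio of these bounds is [exp L], [n |f_k - f'_k| <= exp L * T],
    while [S <= T'], whence [|c S| <= exp L]. *)
Require Import Defs.
From mathcomp Require Import all_boot all_order all_algebra.
From mathcomp Require Import all_reals sequences exp.
From mathcomp Require Import ring lra.

Import Order.TTheory GRing.Theory Num.Theory.
Local Open Scope ring_scope.

Lemma dotp_ge0 (R : realType) (p : nat) (u : 'rV[R]_p) : 0 <= dotp u u.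
Proof. by apply: sumr_ge0 => i _; rewrite -expr2 sqr_ge0. Qed.

Lemma dotp_sqr_le (R : realType) (p : nat) (u v : 'rV[R]_p) :
  dotp u v ^+ 2 <= dotp u u * dotp v v.
Proof.
(* Lagrange's identity *)
have : 0 <= \sum_i \sum_j (u 0 i * v 0 j - u 0 j * v 0 i) ^+ 2.
  by apply: sumr_ge0 => i _; apply: sumr_ge0 => j _; exact: sqr_ge0.
have -> : \sum_i \sum_j (u 0 i * v 0 j - u 0 j * v 0 i) ^+ 2 =
    dotp u u * dotp v v + dotp v v * dotp u u - 2 * dotp u v ^+ 2.
  rewrite expr2 /dotp !big_distrlr mulr_sumr -sumrN -!big_split /=.
  apply: eq_bigr => i _; rewrite mulr_sumr -sumrN -!big_split /=.
  by apply: eq_bigr => j _; ring.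
by move=> ?; lra.
Qed.

Lemma normr_dotp_le (R : realType) (p : nat) (u v : 'rV[R]_p) :
  `|dotp u v| <= norm2 u * norm2 v.
Proof.
by rewrite -sqrtr_sqr -sqrtrM ?dotp_ge0// ler_wsqrtr// dotp_sqr_le.
Qed.

Lemma inverse_prob_bounds (R : realType) (p n : nat) (lambda : 'rV[R]_p)
    (D : dataset R p n) (i : 'I_n) (L : R) :
  `|dotp (covariate D i) lambda| <= L ->
  1 + expR (- L) <= inverse_prob lambda D i <= 1 + expR L.
Proof.
rewrite ler_norml /inverse_prob => /andP[hl hu].
(* The factor [2 * a - 1] is 1 or -1, and the interval from [- L] to [L] is symmetric, so both
   treatments obey the same bounds. *)
by rewrite !lerD2l !ler_expR; case: (treatment D i) => /=; apply/andP; split; lra.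
Qed.

(** Each term is at most the whole sum, so its square is at most the term times that sum. *)
Lemma sum_sqr_le_sqr_sum (R : realDomainType) (I : finType) (P : pred I)
    (f : I -> R) :
  (forall i, 0 <= f i) ->
  \sum_(i | P i) f i ^+ 2 <= (\sum_(i | P i) f i) ^+ 2.
Proof.
move=> f0; rewrite expr2 mulr_suml ler_sum// => i Pi.
by rewrite expr2 ler_wpM2l// (bigD1 i)//= lerDl sumr_ge0.
Qed.

(** The logistic form is left out: normalization is scale invariant, so the sensitivity is governed
    by the ratio of the two bounds alone. *)
Lemma norm2_normalized_sub_le (R : realType) (n : nat) (f g : 'I_n -> R)
    (l u : R) (k : 'I_n) :
  0 < l ->
  (forall i, l <= f i <= u) -> (forall i, l <= g i <= u) ->
  (forall i, i != k -> f i = g i) ->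
  norm2 (\row_i (n%:R * f i / \sum_j f j) - \row_i (n%:R * g i / \sum_j g j))
    <= Num.sqrt 2 * (u / l).
Proof.
move=> l0 hf hg fg.
have f0 i : 0 <= f i by case/andP: (hf i) => ? _; lra.
set S := \sum_(i | i != k) f i.
have S0 : 0 <= S by apply: sumr_ge0 => i _; exact: f0.
have Tf : \sum_i f i = f k + S by rewrite (bigD1 k).
have Tg : \sum_i g i = g k + S.
  by rewrite (bigD1 k)//=; congr (_ + _); apply: eq_bigr => i /fg.
have T_ge : n%:R * l <= f k + S.
  rewrite -Tf mulr_natl -[n in _ *+ n]card_ord -sumr_const ler_sum// => i _.
  by case/andP: (hf i).
rewrite Tf Tg.
case/andP: (hf k) => fl fu; case/andP: (hg k) => gl gu.
have Tf0 : 0 < f k + S by lra.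
have Tg0 : 0 < g k + S by lra.
have Tf1 : f k + S != 0 by rewrite gt_eqF.
have Tg1 : g k + S != 0 by rewrite gt_eqF.
pose c := n%:R * (f k - g k) / ((f k + S) * (g k + S)).
have cS : `|c * S| <= u / l.
  (* [c * S] splits into three factors: [h1] averages the lower bound [l], [h2] uses [0 <= g k], and
     [h3] holds since both values lie between [l > 0] and [u]. *)
  have h1 : n%:R / (f k + S) <= l^-1.
    by rewrite ler_pdivrMr// mulrC ler_pdivlMr.
  have h2 : S / (g k + S) <= 1 by rewrite ler_pdivrMr//; lra.
  have h3 : `|f k - g k| <= u by rewrite ler_norml; apply/andP; split; lra.
  have -> : c * S = (f k - g k) * (n%:R / (f k + S)) * (S / (g k + S)).
    by rewrite /c; field; rewrite Tf1 Tg1.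
  have n0 : 0 <= n%:R / (f k + S) by rewrite divr_ge0// ltW.
  have s0 : 0 <= S / (g k + S) by rewrite divr_ge0// ltW.
  rewrite (normrM _ (S / _)) (normrM _ (n%:R / _)).
  rewrite (ger0_norm n0) (ger0_norm s0) -[leRHS]mulr1.
  by apply: ler_pM => //; [exact: mulr_ge0 | exact: ler_pM].
have ul0 : 0 <= u / l by exact: le_trans cS.
rewrite -(ger0_norm ul0) -sqrtr_sqr -sqrtrM// ler_wsqrtr//.
(* Over the common denominator the product [f k * g k] cancels at [k], leaving [(f k - g k) * S];
   elsewhere only the totals differ, by [f k - g k]. *)
have -> : dotp (\row_i (n%:R * f i / (f k + S)) - \row_i (n%:R * g i / (g k + S)))
    (\row_i (n%:R * f i / (f k + S)) - \row_i (n%:R * g i / (g k + S)))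
    = c ^+ 2 * (S ^+ 2 + \sum_(i | i != k) f i ^+ 2).
  rewrite /dotp (bigD1 k)//= !mxE [RHS]mulrDr mulr_sumr; congr (_ + _).
    by rewrite /c; field; rewrite Tf1 Tg1.
  apply: eq_bigr => i ik; rewrite !mxE -fg// /c.
  by field; rewrite Tf1 Tg1.
(* All other coordinates together weigh no more than coordinate [k], whence the factor 2 under the
   root. *)
have : c ^+ 2 * \sum_(i | i != k) f i ^+ 2 <= c ^+ 2 * S ^+ 2.
  by rewrite ler_wpM2l ?sqr_ge0// sum_sqr_le_sqr_sum.
have : (c * S) ^+ 2 <= (u / l) ^+ 2 by rewrite -real_normK ?num_real// lerXn2r ?nnegrE.
by rewrite exprMn mulrDr => ? ?; lra.
Qed.

Theorem proposition4p5 (R : realType) (p n : nat) (lambda : 'rV[R]_p)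
    (D D' : dataset R p n) (M R_IPW : R)
    (hDD' : differ_at_one D D')
    (hM : forall i : 'I_n, norm2 (covariate D i) <= M)
    (hM' : forall i : 'I_n, norm2 (covariate D' i) <= M)
    (hlambda : norm2 lambda <= R_IPW) :
  norm2 (ipw_weights lambda D - ipw_weights lambda D')
    <= Num.sqrt 2 * expR (M * R_IPW).
Proof.
case: hDD' => k hk.
have L_ge (x : 'rV[R]_p) : norm2 x <= M -> `|dotp x lambda| <= M * R_IPW.
  move=> hx; apply: le_trans (normr_dotp_le _ _ _ _) _.
  by rewrite ler_pM ?sqrtr_ge0.
set E := expR (M * R_IPW).
have E0 : 0 < E := expR_gt0 _.
(* Since [E * (1 + E^-1) = E + 1], the target constant is exactly the ratio of the bounds on the
   inverse probabilities. *)
have -> : E = (1 + E) / (1 + expR (- (M * R_IPW))).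
  rewrite expRN -/E; field.
  by rewrite !gt_eqF//; lra.
apply: norm2_normalized_sub_le (k) _ _ _ _.
- by rewrite addr_gt0 ?expR_gt0.
- by move=> i; exact/inverse_prob_bounds/L_ge.
- by move=> i; exact/inverse_prob_bounds/L_ge.
- by move=> i /hk; rewrite /inverse_prob /treatment /covariate => ->.
Qed.
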